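(* Given an instance $\mathbf{W}=(W_1,\ldots,W_m)$ of the Universal Mismatch problem with $m$ binary partial words each of length $p$, one can compute in $\mathcal{O}(|T|)$ time a binary partial word $T$ of length $\Theta((p+m)^2)$ such that $\mathbf{W}$ is a YES-instance of Universal Mismatch if and only if $T$ has a solid cover of length at most $d=4p+3$ (i.e., $(T,d)$ is a YES-instance of Shortest Cover in Partial Words).
   Context: Binary partial words are strings over $\{0,1,\diamondsuit\}$, where $\diamondsuit$ is a don't care symbol matching both $0$ and $1$; a solid string contains no $\diamondsuit$. Two partial words $U,V$ match ($U\approx V$) if $|U|=|V|$ and for each $i$, $U[i]=V[i]$ or one of them is $\diamondsuit$. A solid string $S$ occurs in $T$ at $j$ if $S\approx T[j..j+|S|-1]$; $S$ is a (solid) cover of $T$ if every position $i$ of $T$ lies inside some occurrence of $S$. Universal Mismatch: given binary partial words $W_1,\ldots,W_m$ each of length $p$, decide whether there exists a binary partial word $V$ of length $p$ with $V\not\approx W_i$ for every $i$. Shortest Cover in Partial Words: given a partial word $T$ over an alphabet $\Sigma$ and an integer $d$, decide whether $T$ has a solid cover of length at most $d$. *)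

(* Defs.v *)
From mathcomp Require Import all_boot.

Set Implicit Arguments.
Unset Strict Implicit.
Unset Printing Implicit Defensive.

(* [None] is the don't care symbol. *)
Definition pword (A : Type) := seq (option A).

Section PartialWords.
Variable A : eqType.

Definition sym_match (a b : option A) : bool :=
  [|| a == b, a == None | b == None].

(* [all2] is false on sequences of different sizes. *)
Definition pmatch (U V : pword A) : bool := all2 sym_match U V.

(* Positions are numbered from 0.  When the window T[j .. j + |S| - 1] sticks
   out of T, [take] returns a shorter word and the match fails. *)
Definition occurs_at (S : seq A) (T : pword A) (j : nat) : bool :=
  pmatch (map Some S) (take (size S) (drop j T)).

Definition solid_cover (S : seq A) (T : pword A) : Prop :=
  forall i, i < size T ->
    exists j, j <= i < j + size S /\ occurs_at S T j.

Definition shortest_cover_yes (T : pword A) (d : nat) : Prop :=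
  exists S : seq A, size S <= d /\ solid_cover S T.

End PartialWords.

Definition universal_mismatch_yes (m p : nat)
    (W : m.-tuple (p.-tuple (option bool))) : Prop :=
  exists V : p.-tuple (option bool), forall i : 'I_m, ~~ pmatch V (tnth W i).

(* Random access machine with unit-cost instructions, in structured form.
   A program mentions finitely many registers; [Read] and [Write] address an
   unbounded memory through a register, and [Emit] appends the contents of a
   register to a write-only output.  The only arithmetic is +1 and -1, so no
   value exceeds (largest constant or input value) + (number of steps): words
   of logarithmic length suffice and unit cost is legitimate. *)

Inductive cmd : Type :=
| Skip
| Const of nat & nat      (* r := n *)
| Move of nat & nat       (* r := s *)
| Inc of nat              (* r := r + 1 *)
| Dec of nat              (* r := r - 1, truncated at 0 *)
| Read of nat & nat       (* r := mem[s] *)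
| Write of nat & nat      (* mem[r] := s *)
| Emit of nat
| Seq of cmd & cmd
| IfLt of nat & nat & cmd & cmd   (* branches on r < s *)
| WhileLt of nat & nat & cmd.     (* loops as long as r < s *)

Record state := State {
  reg : nat -> nat;
  mem : nat -> nat;
  out : seq nat
}.

Definition upd (f : nat -> nat) (k v : nat) : nat -> nat :=
  fun i => if i == k then v else f i.

Definition set_reg (s : state) (r v : nat) : state :=
  State (upd (reg s) r v) (mem s) (out s).

(* [exec c s t s']: started in state [s], the program [c] halts in state [s']
   after exactly [t] steps; instructions and tests cost one step each. *)
Inductive exec : cmd -> state -> nat -> state -> Prop :=
| exec_skip s : exec Skip s 1 s
| exec_const s r n : exec (Const r n) s 1 (set_reg s r n)
| exec_move s r r' : exec (Move r r') s 1 (set_reg s r (reg s r'))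
| exec_inc s r : exec (Inc r) s 1 (set_reg s r (reg s r).+1)
| exec_dec s r : exec (Dec r) s 1 (set_reg s r (reg s r).-1)
| exec_read s r r' : exec (Read r r') s 1 (set_reg s r (mem s (reg s r')))
| exec_write s r r' :
    exec (Write r r') s 1
      (State (reg s) (upd (mem s) (reg s r) (reg s r')) (out s))
| exec_emit s r :
    exec (Emit r) s 1 (State (reg s) (mem s) (rcons (out s) (reg s r)))
| exec_seq c1 c2 s t1 s1 t2 s2 :
    exec c1 s t1 s1 -> exec c2 s1 t2 s2 -> exec (Seq c1 c2) s (t1 + t2) s2
| exec_if_true r r' c1 c2 s t s1 :
    reg s r < reg s r' -> exec c1 s t s1 -> exec (IfLt r r' c1 c2) s t.+1 s1
| exec_if_false r r' c1 c2 s t s1 :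
    reg s r' <= reg s r -> exec c2 s t s1 -> exec (IfLt r r' c1 c2) s t.+1 s1
| exec_while_true r r' c s t1 s1 t2 s2 :
    reg s r < reg s r' -> exec c s t1 s1 -> exec (WhileLt r r' c) s1 t2 s2 ->
    exec (WhileLt r r' c) s (t1 + t2).+1 s2
| exec_while_false r r' c s :
    reg s r' <= reg s r -> exec (WhileLt r r' c) s 1 s.

Definition sym_code (a : option bool) : nat :=
  match a with
  | Some b => nat_of_bool b
  | None => 2
  end.

(* Registers 0 and 1 hold m and p, and the m * p letters W_1 W_2 ... W_m are
   laid out one per cell in memory from address 0; everything else is 0. *)
Definition input_state (m p : nat)
    (W : m.-tuple (p.-tuple (option bool))) : state :=
  State (nth 0 [:: m; p])
        (nth 0 (map sym_code (flatten (map val W))))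
        [::].

Definition outputs_in_time (c : cmd) (s : state) (T : pword bool) (t : nat)
    : Prop :=
  exists2 s' : state, exec c s t s' & out s' = map sym_code T.

(* Main.v *)
Require Import Defs.
From mathcomp Require Import all_boot.
From mathcomp Require Import zify.

(** Cover words have the form 1(10)^(p+1) v_0 0 v_1 0 ... v_(p-1) 0, where the
    bits v encode a total word V (read backwards).  The part [prefix] of the
    first gadget forces this form, up to truncation.

    In the gadget of W_i a solid 1, at position c, must be covered.  An occurrence
    of the cover word covering c starts at c - o with o odd, since the letters at
    even offsets o > 0 are 0 and o = 0 is excluded by the 0 at c + 1.  The gadget
    has a 0 at each c - o except at 2p offsets, two for each letter W_i[j]: the
    offset of the bit for j, left open when W_i[j] = 0 (then the 1 at c forces
    that bit to be 1), and the offset of the fixed 1 lying 2p + 2 before it, left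
    open when W_i[j] = 1 (then the 0 at c + 2p + 2 forces the bit to be 0).  So c
    can be covered iff V and W_i mismatch somewhere.  The zeros left of c do not
    disturb the admissible occurrences, which meet them at even offsets > 0; the
    zero at c + 2p + 2 lies beyond an occurrence with a bit of V at c.
    Everything outside c, c + 1 is tiled by occurrences independent of V. *)

Set Implicit Arguments.
Unset Strict Implicit.
Unset Printing Implicit Defensive.

(** * Words *)

Lemma flatten_mkseqS (A : Type) (w : nat -> seq A) n :
  flatten (mkseq w n.+1) = flatten (mkseq w n) ++ w n.
Proof. by rewrite /mkseq -addn1 iotaD map_cat flatten_cat /= cats0. Qed.

Lemma flatten_mkseq_nseq (A : Type) (x : A) k n :
  flatten (mkseq (fun=> nseq k x) n) = nseq (n * k) x.
Proof.
elim: n => // n IH; rewrite flatten_mkseqS IH mulSn addnC.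
by rewrite nseqD.
Qed.

Lemma size_flatten_mkseq (A : Type) (w : nat -> seq A) k n :
  (forall i, i < n -> size (w i) = k) -> size (flatten (mkseq w n)) = n * k.
Proof.
elim: n => // n IH sw; rewrite flatten_mkseqS size_cat sw // IH ?mulSn 1?addnC //.
by move=> i lin; apply: sw; apply: ltnW.
Qed.

Lemma nth_flatten_mkseq (A : Type) (x0 : A) (w : nat -> seq A) k n i j :
  (forall i, i < n -> size (w i) = k) -> i < n -> j < k ->
  nth x0 (flatten (mkseq w n)) (i * k + j) = nth x0 (w i) j.
Proof.
move=> sw lin ljk; elim: n => // n IH in sw lin *.
have sw' i' : i' < n -> size (w i') = k by move=> ?; apply: sw; lia.
rewrite flatten_mkseqS nth_cat (size_flatten_mkseq sw').
move: lin; rewrite ltnS leq_eqVlt => /orP[/eqP-> | lin].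
  by rewrite ltnNge leq_addr /= addKn.
by rewrite ifT ?IH //; nia.
Qed.

Definition pairs (A : Type) (f g : nat -> A) n : seq A :=
  flatten (mkseq (fun j => [:: f j; g j]) n).

Lemma size_pairs (A : Type) (f g : nat -> A) n : size (pairs f g n) = n * 2.
Proof. exact: size_flatten_mkseq. Qed.

Lemma nth_pairs (A : Type) (x0 : A) (f g : nat -> A) n i : i < n * 2 ->
  nth x0 (pairs f g n) i = if odd i then g i./2 else f i./2.
Proof.
move=> lin; rewrite -{1}(odd_double_half i) addnC -muln2.
rewrite nth_flatten_mkseq //; [by case: odd | lia | by case: odd].
Qed.

(** * Occurrences and covers: matching letter by letter, concatenation, wild cards *)

Section Occurrences.
Variable A : eqType.
Implicit Types (S : seq A) (T U : pword A).

Lemma pmatchP U T :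
  reflect (size U = size T /\
    forall i, i < size U -> sym_match (nth None U i) (nth None T i))
    (pmatch U T).
Proof.
rewrite /pmatch; elim: U T => [|a U IH] [|b T] /=; try by constructor; case.
  by constructor.
apply: (iffP andP) => [[ab /IH[-> UT]] | [[sUT] UT]].
  by split=> // -[|i] //=; apply: UT.
by split; [exact: (UT 0) | apply/IH; split=> // i /(UT i.+1)].
Qed.

Lemma sym_match_Some a (b : option A) :
  sym_match (Some a) b = (b == None) || (b == Some a).
Proof. by rewrite /sym_match /= orbC [Some a == b]eq_sym. Qed.

(** Nonemptiness of [S] is what bounds [j]: the empty word occurs at every [j], even past the end of
    [T]. *)
Lemma occurs_atP x0 S T j : 0 < size S ->
  reflect (j + size S <= size T /\
    forall i, i < size S -> sym_match (Some (nth x0 S i)) (nth None T (j + i)))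
    (occurs_at S T j).
Proof.
move=> S0; rewrite /occurs_at.
apply: (iffP (pmatchP _ _)); rewrite !size_map size_take_min size_drop.
  case=> sz ST; have szT : j + size S <= size T by lia.
  split=> // i iS; have := ST i iS.
  by rewrite (nth_map x0) // nth_take // nth_drop.
case=> szT ST; split=> [|i iS]; first by lia.
by rewrite (nth_map x0) // nth_take // nth_drop ST.
Qed.

Lemma occurs_at_catl S T U j : 0 < size S ->
  occurs_at S T j -> occurs_at S (T ++ U) j.
Proof.
case: S => // x S _; set S' := x :: S.
have S0 : 0 < size S' by [].
move=> /(occurs_atP x _ _ S0)[szT ST]; apply/(occurs_atP x _ _ S0).
rewrite size_cat; split=> [|i iS]; first by lia.
by rewrite nth_cat ifT ?ST //; lia.
Qed.

Lemma occurs_at_catr S T U j :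
  occurs_at S U j -> occurs_at S (T ++ U) (size T + j).
Proof.
by rewrite /occurs_at drop_cat ifF ?addKn //; apply/negbTE; rewrite -leqNgt leq_addr.
Qed.

Lemma solid_cover_cat S T U :
  0 < size S -> solid_cover S T -> solid_cover S U -> solid_cover S (T ++ U).
Proof.
move=> S0 cT cU i; rewrite size_cat.
case: (ltnP i (size T)) => [/cT[j [ij occ]] _ | Ti].
  by exists j; split=> //; apply: occurs_at_catl.
rewrite -ltn_subLR // => /cU[j [ij occ]].
by exists (size T + j); split; [lia | apply: occurs_at_catr].
Qed.

Lemma solid_cover_flatten S (w : nat -> pword A) n :
  0 < size S -> (forall i, i < n -> solid_cover S (w i)) ->
  solid_cover S (flatten (mkseq w n)).
Proof.
move=> S0; elim: n => // n IH cw; rewrite flatten_mkseqS.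
apply: solid_cover_cat => //; last exact: cw.
by apply: IH => i lin; apply: cw; apply: ltnW.
Qed.

Lemma solid_cover_match S T : pmatch (map Some S) T -> solid_cover S T.
Proof.
move=> ST i iT; have [sz _] := pmatchP _ _ ST; rewrite size_map in sz.
by exists 0; split; [lia | rewrite /occurs_at drop0 sz take_size].
Qed.

Lemma solid_cover_nseq S n : 0 < size S -> size S <= n ->
  solid_cover S (nseq n None).
Proof.
case: S => // x S _; set S' := x :: S => Sn i; rewrite size_nseq => lin.
have S0 : 0 < size S' by [].
(* Start the window at [i], or shift it left until it fits into the word. *)
exists (minn i (n - size S')); split; first by lia.
apply/(occurs_atP x _ _ S0); rewrite size_nseq; split=> [|j _]; first by lia.
by rewrite nth_nseq if_same.
Qed.

End Occurrences.

(** * The reduction *)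

(** A don't care letter closes the guards for both values of [b], as it should: it can never be
    mismatched. *)
Definition guard (b : bool) (a : option bool) : option bool :=
  if a == Some b then None else Some false.

Definition prefix p : pword bool :=
  [:: Some true; Some true; Some false]
    ++ pairs (fun=> Some true) (fun=> Some false) p
    ++ pairs (fun=> None) (fun=> Some false) p.

(* Everything to the left of the position c; the even positions t > 0 are the
   c - o for odd o. *)
Definition selector p (w : nat -> option bool) : pword bool :=
  [:: None] ++ pairs (fun=> None) (fun j => guard false (w j)) p
    ++ [:: None; Some false] ++ pairs (fun=> None) (fun j => guard true (w j)) p.

(** As long as a cover word, so that a single aligned occurrence covers it. It starts at [c + 2], so
    its only solid letter is the 0 at [c + 2p + 2]. *)
Definition trailer p : pword bool :=
  nseq (p * 2) None ++ [:: Some false] ++ nseq (p * 2) None ++ nseq 2 None.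

Definition core p w : pword bool :=
  selector p w ++ [:: Some true; Some false] ++ trailer p.

(** The first [4 * p + 3] closing wild cards make room for a whole cover word; the last [m] supply
    the [m^2] term of the length. *)
Definition gadget m p w : pword bool :=
  prefix p ++ core p w ++ nseq (p * 4) None ++ nseq 3 None ++ nseq m None.

(* The trailing wild cards supply the p^2 term of the length when p exceeds m. *)
Definition instance m p (w : nat -> nat -> option bool) : pword bool :=
  flatten (mkseq (fun i => gadget m p (w i)) m) ++ nseq (p * (p * 4 + 3)) None.

(** * Lengths and letters of the building blocks *)

Lemma size_prefix p : size (prefix p) = 4 * p + 3.
Proof. by rewrite !size_cat !size_pairs /=; lia. Qed.

Lemma size_selector p w : size (selector p w) = 4 * p + 3.
Proof. by rewrite !size_cat !size_pairs /=; lia. Qed.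

Lemma size_trailer p : size (trailer p) = 4 * p + 3.
Proof. by rewrite !size_cat !size_nseq /=; lia. Qed.

Lemma size_core p w : size (core p w) = 8 * p + 8.
Proof. by rewrite /core size_cat size_selector size_cat size_trailer /=; lia. Qed.

Lemma size_gadget m p w : size (gadget m p w) = 16 * p + 14 + m.
Proof. rewrite /gadget size_cat size_prefix size_cat size_core !size_cat !size_nseq.
by lia. Qed.

Lemma size_instance m p w :
  size (instance m p w) = m * (16 * p + 14 + m) + p * (4 * p + 3).
Proof.
rewrite size_cat size_nseq (@size_flatten_mkseq _ _ (16 * p + 14 + m)); first by lia.
by move=> i _; rewrite size_gadget.
Qed.

Lemma nth_prefix p t : t < 4 * p + 3 ->
  nth None (prefix p) t =
    if (t == 0) || odd t && (t <= 2 * p + 1) then Some true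
    else if odd t then None else Some false.
Proof.
move=> tp; rewrite nth_cat /=.
case: (ltnP t 3) => [|t3]; first by case: t tp => [|[|[|]]] //=; rewrite addn1.
rewrite nth_cat size_pairs.
have odd_t : odd t = ~~ odd (t - 3) by lia.
case: ifP => [? | /negbT ?]; rewrite nth_pairs ?odd_t; try lia;
  case: (boolP (odd (t - 3))) => ? //=.
- by rewrite ifF //; lia.
- by rewrite ifT //; lia.
- by rewrite ifT ?ifF //; lia.
- by rewrite !ifF //; lia.
Qed.

Lemma nth_selector p w t : t < 4 * p + 3 ->
  nth None (selector p w) t =
    if (t == 0) || odd t then None
    else if t == 2 * p + 2 then Some false
    else if t < 2 * p + 2 then guard false (w (t./2.-1))
    else guard true (w (t./2 - p - 2)).
Proof.
move=> tp; rewrite nth_cat; case: ltnP => [|]; first by case: t tp.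
rewrite [size _]/= => t1.
rewrite nth_cat size_pairs; have odd_t : odd t = ~~ odd (t - 1) by lia.
have -> : (t == 0) = false by lia.
rewrite odd_t orFb; case: ltnP => t2.
  rewrite nth_pairs //; case: ifP => // odd_t1 /=.
  by rewrite ifF ?ifT; [congr (guard _ (w _)) | |]; lia.
rewrite nth_cat /=; case: ltnP => t3.
  case: (boolP (odd (t - 1))) => odd_t1 /=.
    by rewrite (_ : t - 1 - p * 2 = 1) ?ifT //; lia.
  by rewrite (_ : t - 1 - p * 2 = 0) //; lia.
rewrite nth_pairs; last by lia.
have -> : odd (t - 1 - p * 2 - 2) = odd (t - 1) by lia.
case: ifP => // odd_t1 /=.
by rewrite !ifF; [congr (guard _ (w _)) | |]; lia.
Qed.

Lemma nth_trailer p t :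
  nth None (trailer p) t = if t == 2 * p then Some false else None.
Proof.
rewrite /trailer -nseqD !nth_cat size_nseq !nth_nseq /= !if_same.
case: ltnP => tp; first by rewrite ifF //; lia.
case: ltnP => tp1; last by rewrite ifF //; lia.
by rewrite (_ : t - p * 2 = 0) ?ifT //; lia.
Qed.

Lemma nth_core p w t :
  nth None (core p w) t =
    if t < 4 * p + 3 then nth None (selector p w) t
    else if t == 4 * p + 3 then Some true
    else if (t == 4 * p + 4) || (t == 6 * p + 5) then Some false else None.
Proof.
rewrite nth_cat size_selector; case: ltnP => // tp.
rewrite nth_cat nth_trailer /=; case: ltnP => tp1.
  case: eqP => [->|tp2]; first by rewrite subnn.
  by rewrite (_ : t - _ = 1) ?ifT //; lia.
rewrite (_ : (t == 4 * p + 3) = false); last by lia.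
by congr (if _ then _ else _); lia.
Qed.

(** * Cover words and the blocks they cover whatever [V] is *)

Definition letter V p t : bool :=
  (t == 0) || odd t && ((t <= 2 * p + 1) || V ((4 * p + 1 - t)./2)).

Definition cover_word V p : seq bool := mkseq (letter V p) (4 * p + 3).

Lemma cover_word_prefix V p : pmatch (map Some (cover_word V p)) (prefix p).
Proof.
apply/pmatchP; rewrite size_map size_mkseq size_prefix; split=> // t tp.
rewrite (nth_map false) ?size_mkseq // nth_mkseq // nth_prefix //.
rewrite sym_match_Some /letter.
by case: (t == 0) => //=; case: odd => //=; case: leqP => //= ->.
Qed.

Lemma guardNtrue b a : (guard b a == None) || (guard b a == Some false).
Proof. by rewrite /guard; case: ifP. Qed.

(** This is all that most occurrences need to know about the selector: aligned with it, or started
    at an even position of it, a cover word meets its zeros at even offsets, and even positive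
    offsets carry 0. *)
Lemma nth_selector_even p w t : t < 4 * p + 3 ->
  (nth None (selector p w) t == None) ||
  (nth None (selector p w) t == Some false) && (0 < t) && ~~ odd t.
Proof.
move=> tp; rewrite nth_selector //.
case: (posnP t) => [-> | t0] //=.
case: odd => //=; rewrite !andbT.
by case: (t == _) => //; case: ifP => _; exact: guardNtrue.
Qed.

Lemma cover_word_selector V p w :
  pmatch (map Some (cover_word V p)) (selector p w).
Proof.
apply/pmatchP; rewrite size_map size_mkseq size_selector; split=> // t tp.
rewrite (nth_map false) ?size_mkseq // nth_mkseq // sym_match_Some.
case/orP: (nth_selector_even w tp) => [-> // | /andP[/andP[/eqP-> t0] ot]].
by rewrite /letter (negbTE ot) orbF eqn0Ngt t0 eqxx.
Qed.

Lemma cover_word_trailer V p : 0 < p ->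
  pmatch (map Some (cover_word V p)) (trailer p).
Proof.
move=> p0.
apply/pmatchP; rewrite size_map size_mkseq size_trailer; split=> // t tp.
rewrite (nth_map false) ?size_mkseq // nth_mkseq // sym_match_Some nth_trailer.
(* The offset [2 * p] is even, and positive because [p] is; at offset 0 the cover word has a 1. *)
case: (t =P 2 * p) => // ->; rewrite /letter mul2n odd_double orbF.
by rewrite double_eq0 eqn0Ngt p0.
Qed.

(** * From a mismatching word to a cover *)

Definition mismatch_at (V : nat -> bool) (w : nat -> option bool) j :=
  w j == Some (~~ V j).

Lemma occurs_core V p w j : j < p -> mismatch_at V w j ->
  exists2 s, 1 < s < 4 * p + 3 & occurs_at (cover_word V p) (core p w) s.
Proof.
move=> jp /eqP wj.
(* These are the selector positions opened for [j]. From the first one, [c = 4p + 3] is at offset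
   [4p + 1 - 2j], which carries [V j]; from the second, at offset [2p - 1 - 2j], which carries a
   fixed 1. *)
exists (if V j then 2 * j + 2 else 2 * p + 4 + 2 * j); first by case: ifP; lia.
apply/(occurs_atP false); rewrite size_mkseq; first by lia.
rewrite size_core; split=> [|t tp]; first by case: ifP; lia.
rewrite nth_mkseq // sym_match_Some nth_core.
set s := (if V j then _ else _).
have odds : odd s = false by rewrite /s; case: ifP; lia.
have s_le : s <= 4 * p + 2 by rewrite /s; case: ifP; lia.
case: ltnP => sp.
  case: (t =P 0) => [-> | /eqP t0].
    rewrite addn0 nth_selector; last by rewrite /s; case: ifP; lia.
    apply/orP; left; rewrite odds orbF.
    rewrite /s /guard; case Vj: (V j) wj => wj.
      do 2![rewrite ifF; last by lia]; rewrite ifT; last by lia.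
      by rewrite (_ : _.-1 = j) ?wj //; lia.
    do 3![rewrite ifF; last by lia].
    by rewrite (_ : _ - 2 = j) ?wj //; lia.
  case/orP: (nth_selector_even w sp) => [-> // | /andP[/andP[/eqP-> _]]].
  by rewrite oddD odds addFb => ot; rewrite /letter (negbTE t0) (negbTE ot).
case: (s + t =P 4 * p + 3) => [st | sp0].
  rewrite /letter.
  have -> : odd t by lia.
  move: st; rewrite /s; case Vj: (V j) => st.
    by rewrite (_ : _./2 = j) ?Vj ?orbT //; lia.
  by rewrite (_ : t <= _ = true) ?orbT //; lia.
case: ifP => // /orP[] /eqP st.
  have ot : odd t = false by lia.
  have t0 : (t == 0) = false by lia.
  by rewrite /letter ot t0.
(* At the 0 of the trailer: the first kind of occurrence has already ended, the second one has
   [V j], which is 0, there. *)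
have {s_le odds} tE : t = 6 * p + 5 - s by lia.
move: tE; rewrite /s; case Vj: (V j) => tE; first by lia.
rewrite /letter (_ : (t == 0) = false); last by lia.
rewrite (_ : t <= _ = false); last by lia.
by rewrite (_ : _./2 = j) ?Vj ?andbF //; lia.
Qed.

Lemma solid_cover_core V p w j : j < p -> mismatch_at V w j ->
  solid_cover (cover_word V p) (core p w).
Proof.
move=> jp mism; have [s s_bounds occ] := occurs_core jp mism.
have S0 : 0 < size (cover_word V p) by rewrite size_mkseq addn3.
move=> i; rewrite size_core => ip.
case: (ltnP i (4 * p + 3)) => ip1.
  have [|k [ik occk]] := solid_cover_match (cover_word_selector V p w) (i := i).
    by rewrite size_selector.
  by exists k; split; [lia | apply: occurs_at_catl].
(* The bounds [1 < s < 4 * p + 3] say exactly that the occurrence at [s] contains both [c] and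
   [c + 1]. *)
case: (ltnP i (4 * p + 5)) => ip2.
  by exists s; split=> //; rewrite size_mkseq; lia.
have ip3 : i - (4 * p + 5) < size (trailer p) by rewrite size_trailer; lia.
have p0 : 0 < p by lia.
have [k [ik occk]] := solid_cover_match (cover_word_trailer V p0) ip3.
exists (4 * p + 5 + k); split; first by lia.
rewrite /core catA.
have -> : 4 * p + 5 = size (selector p w ++ [:: Some true; Some false]).
  by rewrite size_cat size_selector /=; lia.
exact: occurs_at_catr.
Qed.

Lemma solid_cover_gadget V m p w j : j < p -> mismatch_at V w j ->
  solid_cover (cover_word V p) (gadget m p w).
Proof.
move=> jp mism; have S0 : 0 < size (cover_word V p) by rewrite size_mkseq addn3.
apply: solid_cover_cat => //; first exact/solid_cover_match/cover_word_prefix.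
apply: solid_cover_cat => //; first exact: solid_cover_core mism.
by rewrite -!nseqD; apply: solid_cover_nseq; rewrite // size_mkseq; lia.
Qed.

Lemma solid_cover_instance V m p w :
  (forall i, i < m -> exists2 j, j < p & mismatch_at V (w i) j) ->
  solid_cover (cover_word V p) (instance m p w).
Proof.
move=> mism; have S0 : 0 < size (cover_word V p) by rewrite size_mkseq addn3.
apply: solid_cover_cat => //.
  by apply: solid_cover_flatten => // i /mism[j]; apply: solid_cover_gadget.
case: (posnP p) => [-> | p0]; first by [].
by apply: solid_cover_nseq => //; rewrite size_mkseq; nia.
Qed.

(** * From a short cover to a mismatching word *)

Lemma nth_instance m p w i t : i < m -> t < 16 * p + 14 + m ->
  nth None (instance m p w) (i * (16 * p + 14 + m) + t) =
    nth None (gadget m p (w i)) t.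
Proof.
move=> im tg; have sg i' : i' < m -> size (gadget m p (w i')) = 16 * p + 14 + m.
  by move=> _; rewrite size_gadget.
rewrite nth_cat (size_flatten_mkseq sg) ifT ?nth_flatten_mkseq //.
by nia.
Qed.

Lemma nth_gadget_core m p w t : t < 8 * p + 8 ->
  nth None (gadget m p w) (4 * p + 3 + t) = nth None (core p w) t.
Proof.
by move=> tp; rewrite nth_cat size_prefix ltnNge leq_addr addKn nth_cat size_core tp.
Qed.

Lemma nth_gadget_prefix m p w t : t < 4 * p + 3 ->
  nth None (gadget m p w) t = nth None (prefix p) t.
Proof. by move=> tp; rewrite nth_cat size_prefix tp. Qed.

(** Position 0 can only be covered by an occurrence at 0, which compares [S] with the prefix of the
    first gadget. *)
Lemma cover_prefix m p w S : 0 < m -> size S <= 4 * p + 3 ->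
  solid_cover S (instance m p w) ->
  1 < size S /\ forall t, t < size S ->
    sym_match (Some (nth false S t)) (nth None (prefix p) t).
Proof.
move=> m0 Sp cS.
have nthT t : t < 4 * p + 3 ->
    nth None (instance m p w) t = nth None (prefix p) t.
  move=> tp; rewrite -(nth_gadget_prefix m (w 0)) //.
  by rewrite -nth_instance //; lia.
have [|j [j0 occ]] := cS 0; first by rewrite size_instance; nia.
have S0 : 0 < size S by lia.
have SP t : t < size S ->
    sym_match (Some (nth false S t)) (nth None (prefix p) t).
  move=> tS; have [_ /(_ t tS)] := occurs_atP false _ _ S0 occ.
  by rewrite (_ : j + t = t) ?nthT //; lia.
split=> //; rewrite ltnNge; apply/negP => S1.
(* A one-letter cover would be the word 1, which cannot cover the 0 at position 2. *)
have {}j0 : S = [:: true].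
  by case: S S0 S1 SP {cS Sp occ j0} => [|x []] // _ _ /(_ 0 isT); case: x.
have [|k [k2 /(occurs_atP false _ _ S0)[_ /(_ 0 S0)]]] := cS 2.
  by rewrite size_instance; nia.
rewrite (_ : k + 0 = 2); last by rewrite j0 /= in k2; lia.
by rewrite nthT ?nth_prefix ?addn3 // j0.
Qed.

(* When [S] is too short the missing bits are read as 0. *)
Definition decode S p j := nth false S (4 * p + 1 - 2 * j).

Lemma cover_mismatch m p w S i : i < m -> size S <= 4 * p + 3 ->
  solid_cover S (instance m p w) ->
  exists2 j, j < p & mismatch_at (decode S p) (w i) j.
Proof.
move=> im Sp cS; have m0 : 0 < m by lia.
have [S1 SP] := cover_prefix m0 Sp cS.
have S0 : 0 < size S by lia.
(* The start of the core of gadget [i]; the solid 1 at [c] is at [b + (4 * p + 3)]. *)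
pose b := i * (16 * p + 14 + m) + (4 * p + 3).
have nthT t : t < 8 * p + 8 ->
    nth None (instance m p w) (b + t) = nth None (core p (w i)) t.
  move=> tp; rewrite -(nth_gadget_core m) // -nth_instance //; last by lia.
  by rewrite addnA.
have [|k [kc /(occurs_atP false _ _ S0)[_ occ]]] := cS (b + (4 * p + 3)).
  by rewrite size_instance /b; nia.
(* The offset in [S] of the letter that lies on [c]. *)
pose o := b + (4 * p + 3) - k; have oS : o < size S by lia.
have kE t : k + t = b + (4 * p + 3 + t - o) by rewrite /o; lia.
have So : nth false S o.
  have := occ o oS; rewrite kE nthT; last by lia.
  rewrite nth_core ifF; last by lia.
  rewrite ifT; last by lia.
  by rewrite sym_match_Some; case: nth.
(* If [o = 0], the second letter of [S], a 1 by the prefix, lies on the 0 at [c + 1]. *)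
case: (posnP o) => [o0 | o0].
  have := occ 1 S1; rewrite kE nthT; last by lia.
  rewrite nth_core ifF; last by lia.
  rewrite ifF; last by lia.
  rewrite ifT; last by lia.
  have := SP 1 S1; rewrite nth_prefix; last by lia.
  by rewrite ifT ?addn1 //; case: nth.
(* An even positive [o] is impossible: the prefix forces a 0 there. *)
have := SP o oS; rewrite nth_prefix ?So; last by lia.
case: (boolP (odd o)) => [oo _ | oo]; last by rewrite orbF ifF //; lia.
have T0 := occ 0 S0; rewrite kE addn0 nthT in T0; last by lia.
have S00 : nth false S 0.
  by have := SP 0 S0; rewrite nth_prefix; last lia; case: nth.
move: T0; rewrite S00 nth_core ifT; last by lia.
rewrite nth_selector; last by lia.
rewrite ifF; last by lia.
(* Selector position [2p + 2] means [o = 2p + 1], the only fixed 1 at an odd offset that is paired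
   with no letter; it is closed by a constant 0. The other positions are guards, which must be open
   since the first letter of [S] is 1. *)
case: eqP => // o1; case: ltnP => o2.
  set j := _.-1; rewrite /guard; case: eqP => // wj _.
  have jo : o = 4 * p + 1 - 2 * j by rewrite /j; lia.
  by exists j; [lia | rewrite /mismatch_at wj /decode -jo So].
set j := _ - 2; rewrite /guard; case: eqP => // wj _.
have jo : o = 2 * p - 1 - 2 * j by rewrite /j; lia.
have jp : j < p by lia.
exists j; first by [].
rewrite /mismatch_at wj /decode.
(* The bit for [j] lies on the 0 at [c + 2p + 2], unless [S] ends before it; then [decode] yields 0
   by default. *)
case: (ltnP (4 * p + 1 - 2 * j) (size S)) => [jS | ?]; last by rewrite nth_default.
have := occ _ jS; rewrite kE nthT; last by lia.
rewrite nth_core ifF; last by lia.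
rewrite ifF; last by lia.
rewrite ifT; last by lia.
by case: nth.
Qed.

(** * The program *)

Section Program.
Variable mm : nat -> nat.

(* The registers below [size l] hold [l], the others are scratch. *)
Definition holds (l : seq nat) (o : pword bool) (s : state) : Prop :=
  [/\ forall r, r < size l -> reg s r = nth 0 l r, Defs.mem s = mm
    & out s = map sym_code o].

(** A total-correctness triple with a time bound. The memory can stay fixed at [mm] because the
    program only reads it. *)
Definition runs (l : seq nat) (c : cmd) (n : nat) (w : pword bool) (l' : seq nat) :=
  forall s o, holds l o s ->
    exists t s', [/\ exec c s t s', t <= n & holds l' (o ++ w) s'].

Lemma holds_set l o s r v : r <= size l ->
  holds l o s -> holds (set_nth 0 l r v) o (set_reg s r v).
Proof.
move=> rl [regs ? ?]; split=> // i; rewrite size_set_nth nth_set_nth /= /upd.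
by case: eqP => // ir il; apply: regs; lia.
Qed.

Lemma holds_scratch l o s r v : size l <= r ->
  holds l o s -> holds l o (set_reg s r v).
Proof.
by move=> rl [regs ? ?]; split=> // i il; rewrite /= /upd ifF ?regs //; lia.
Qed.

Lemma holds_rcons l v o s : holds (rcons l v) o s -> holds l o s.
Proof.
move=> [regs ? ?]; split=> // r rl.
by rewrite regs ?size_rcons ?nth_rcons ?rl // ltnW.
Qed.

Lemma holds_rcons_nth l v o s : holds (rcons l v) o s -> reg s (size l) = v.
Proof. by case=> regs _ _; rewrite regs ?size_rcons // nth_rcons ltnn eqxx. Qed.

Lemma set_nth_size (l : seq nat) v : set_nth 0 l (size l) v = rcons l v.
Proof. by elim: l => //= a l ->. Qed.

Lemma set_nth_rcons (l : seq nat) u v :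
  set_nth 0 (rcons l u) (size l) v = rcons l v.
Proof. by elim: l => //= a l ->. Qed.

Lemma runs_seq l c1 n1 w1 l1 c2 n2 w2 l2 :
  runs l c1 n1 w1 l1 -> runs l1 c2 n2 w2 l2 ->
  runs l (Seq c1 c2) (n1 + n2) (w1 ++ w2) l2.
Proof.
move=> h1 h2 s o /h1[t1 [s1 [e1 le1 /h2[t2 [s2 [e2 le2 hs2]]]]]].
exists (t1 + t2), s2; rewrite catA; split=> //; first exact: exec_seq e1 e2.
exact: leq_add.
Qed.

Lemma runs_le l c n w l' n' : runs l c n w l' -> n <= n' -> runs l c n' w l'.
Proof.
move=> h le s o /h[t [s' [e le' hs]]]; exists t, s'; split=> //.
exact: leq_trans le' le.
Qed.

(** Turns the last tracked register back into scratch, free for reuse. *)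
Lemma runs_rcons l c n w l' v : runs l c n w (rcons l' v) -> runs l c n w l'.
Proof.
move=> h s o /h[t [s' [e le hs]]]; exists t, s'; split=> //.
exact: holds_rcons hs.
Qed.

Lemma runs_const l r v : r <= size l -> runs l (Const r v) 1 [::] (set_nth 0 l r v).
Proof.
move=> rl s o hs; exists 1, (set_reg s r v); rewrite cats0.
by split; [exact: exec_const | | exact: holds_set].
Qed.

Lemma runs_move l r r' : r <= size l -> r' < size l ->
  runs l (Move r r') 1 [::] (set_nth 0 l r (nth 0 l r')).
Proof.
move=> rl rl' s o hs; exists 1, (set_reg s r (reg s r')); rewrite cats0.
split; [exact: exec_move | by [] |].
by have [regs _ _] := hs; rewrite regs //; apply: holds_set.
Qed.

Lemma runs_inc l r : r < size l ->
  runs l (Inc r) 1 [::] (set_nth 0 l r (nth 0 l r).+1).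
Proof.
move=> rl s o hs; exists 1, (set_reg s r (reg s r).+1); rewrite cats0.
split; [exact: exec_inc | by [] |].
by have [regs _ _] := hs; rewrite regs //; apply: holds_set => //; apply: ltnW.
Qed.

Lemma runs_read l r r' : r <= size l -> r' < size l ->
  runs l (Read r r') 1 [::] (set_nth 0 l r (mm (nth 0 l r'))).
Proof.
move=> rl rl' s o hs; exists 1, (set_reg s r (Defs.mem s (reg s r'))); rewrite cats0.
split; [exact: exec_read | by [] |].
by have [regs -> _] := hs; rewrite regs //; apply: holds_set.
Qed.

Lemma runs_if l r r' c1 c2 n w l' : r < size l -> r' < size l ->
  runs l (if nth 0 l r < nth 0 l r' then c1 else c2) n w l' ->
  runs l (IfLt r r' c1 c2) n.+1 w l'.
Proof.
move=> rl rl' h s o hs; have [regs _ _] := hs.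
case: ltnP h => ltr h; have [t [s' [e le hs']]] := h s o hs; exists t.+1, s'.
  by split=> //; apply: exec_if_true; rewrite ?regs.
by split=> //; apply: exec_if_false; rewrite ?regs.
Qed.

(** * Emitting fixed words and counted loops *)

Definition emit_sym (a : option bool) : cmd := Seq (Const 9 (sym_code a)) (Emit 9).

Fixpoint emit_word (w : pword bool) : cmd :=
  if w is a :: w' then Seq (emit_sym a) (emit_word w') else Skip.

(** The bound on [size l] makes register 9 scratch. *)
Lemma runs_emit_sym l a : size l <= 9 -> runs l (emit_sym a) 2 [:: a] l.
Proof.
move=> l9 s o /(holds_scratch (sym_code a) l9)[regs memE outE].
exists 2; eexists; split; first exact: (exec_seq (exec_const _ _ _) (exec_emit _ _)).
  by [].
by split=> //=; rewrite outE map_cat -cats1.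
Qed.

Lemma runs_emit_word l w : size l <= 9 ->
  runs l (emit_word w) (2 * size w + 1) w l.
Proof.
move=> l9; elim: w => [|a w IH] /=.
  by move=> s o; rewrite cats0; exists 1, s; split=> //; apply: exec_skip.
rewrite -cat1s mulnS -addnA.
by apply: runs_seq; [exact: runs_emit_sym | exact: IH].
Qed.

Definition for_loop r b body : cmd :=
  Seq (Const r 0) (WhileLt r b (Seq body (Inc r))).

(** [l k] is the loop invariant, and the counter sits in the first register beyond it. A round costs
    [K] plus the test and the increment; the last [+ 2] pays for the initialization and the failing
    test. *)
Lemma runs_for (l : nat -> seq nat) (w : nat -> pword bool) r b body n K :
  (forall k, size (l k) = r) -> b < r -> (forall k, nth 0 (l k) b = n) ->
  (forall k, k < n -> runs (rcons (l k) k) body K (w k) (rcons (l k.+1) k)) ->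
  runs (l 0) (for_loop r b body) (n * (K + 2) + 2) (flatten (mkseq w n)) (l n).
Proof.
move=> sl br lb hbody s o hs.
(* Induction on the number [d] of rounds left, the counter being [n - d]. *)
have while_loop d s' : d <= n ->
    holds (rcons (l (n - d)) (n - d)) (o ++ flatten (mkseq w (n - d))) s' ->
    exists t s'', [/\ exec (WhileLt r b (Seq body (Inc r))) s' t s'',
      t <= d * (K + 2) + 1 & holds (l n) (o ++ flatten (mkseq w n)) s''].
  elim: d s' => [|d IH] s' dn hs'; have rE := holds_rcons_nth hs'.
    have [regs _ _] := holds_rcons hs'; rewrite sl in rE.
    exists 1, s'; split=> //.
      by apply: exec_while_false; rewrite rE regs ?sl ?lb ?subn0.
    by move: hs'; rewrite subn0; exact: holds_rcons.
  have [regs _ _] := holds_rcons hs'; rewrite sl in rE.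
  have kn : n - d.+1 < n by lia.
  have [t1 [s1 [e1 le1 hs1]]] := hbody _ kn _ _ hs'.
  have [t2 [s2 [e2 le2]]] : exists t s', [/\ exec (Inc r) s1 t s', t <= 1
    & holds (rcons (l (n - d)) (n - d)) (o ++ flatten (mkseq w (n - d))) s'].
    have [|t2 [s2 [e2 le2 hs2]]] :=
        @runs_inc (rcons (l (n - d.+1).+1) (n - d.+1)) r _ _ _ hs1.
      by rewrite size_rcons sl.
    exists t2, s2; split=> //; move: hs2; rewrite nth_rcons sl ltnn eqxx.
    rewrite -[X in set_nth _ _ X _](sl (n - d.+1).+1) set_nth_rcons.
    by rewrite cats0 -catA -flatten_mkseqS subnSK.
  move=> /(IH _ (ltnW dn))[t3 [s3 [e3 le3 hs3]]].
  exists (t1 + t2 + t3).+1, s3; split=> //; last by lia.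
  apply: exec_while_true e3; last exact: exec_seq e1 e2.
  by rewrite rE regs ?sl ?lb.
have := holds_set 0 (eq_leq (esym (sl 0))) hs.
rewrite -[X in set_nth _ _ X _](sl 0) set_nth_size => hs0.
have {}hs0 : holds (rcons (l (n - n)) (n - n))
    (o ++ flatten (mkseq w (n - n))) (set_reg s r 0).
  by rewrite subnn cats0.
have [t [s' [e le hs']]] := while_loop n _ (leqnn n) hs0.
exists (1 + t), s'; split=> //; last by lia.
exact: exec_seq (exec_const _ _ _) e.
Qed.

Lemma runs_repeat l r b w : size l = r -> b < r -> r < 9 ->
  runs l (for_loop r b (emit_word w)) (nth 0 l b * (2 * size w + 1 + 2) + 2)
    (flatten (mkseq (fun=> w) (nth 0 l b))) l.
Proof.
move=> sl br r9; apply: (@runs_for (fun=> l)) => // k _.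
by apply: runs_emit_word; rewrite size_rcons sl.
Qed.

(* Register 2 holds the address of the current word, register 4 that of the
   letter being read. *)
Definition emit_guard (b : bool) : cmd :=
  Seq (Read 6 4) (Seq (Const 7 b)
    (IfLt 6 7 (emit_sym (Some false))
      (IfLt 7 6 (emit_sym (Some false)) (emit_sym None)))).

(** Two strict comparisons test equality with [b]; the code 2 of a wild card differs from both bits,
    so it yields 0. *)
Lemma runs_emit_guard m p u i q j b a : mm q = sym_code a ->
  runs [:: m; p; u; i; q; j] (emit_guard b) 6 [:: guard b a] [:: m; p; u; i; q; j].
Proof.
move=> mq; apply: (@runs_rcons _ _ _ _ _ (sym_code a)).
apply: (@runs_rcons _ _ _ _ _ b).
apply: (@runs_seq _ _ 1 [::]); first exact: runs_read.
apply: (@runs_seq _ _ 1 [::]); first exact: runs_const.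
apply: runs_if => //=; rewrite mq /guard.
by case: a b {mq} => [[]|] [] /=; first [exact: (runs_le (runs_emit_sym _ _))
  | apply: runs_if => //=; exact: runs_emit_sym].
Qed.

Definition emit_guards (b : bool) : cmd :=
  Seq (Move 4 2)
    (for_loop 5 1 (Seq (emit_sym None) (Seq (emit_guard b) (Inc 4)))).

(** Register 4 ends at [u + p], the address of the next word, and is therefore kept in the final
    state. *)
Lemma runs_emit_guards m p u i b w :
  (forall j, j < p -> mm (u + j) = sym_code (w j)) ->
  runs [:: m; p; u; i] (emit_guards b) (1 + (p * 11 + 2))
    (pairs (fun=> None) (fun j => guard b (w j)) p) [:: m; p; u; i; u + p].
Proof.
move=> mu; apply: (@runs_seq _ _ 1 [::]); first exact: runs_move.
rewrite /= -[X in [:: _; _; _; _; X]]addn0.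
apply: (@runs_for (fun j => [:: m; p; u; i; u + j]) _ _ _ _ _ 9) => // j jp.
apply: (@runs_seq _ _ 2 [:: None]); first exact: runs_emit_sym.
rewrite -[[:: guard _ _]]cats0.
apply: (@runs_seq _ _ 6); first exact/runs_emit_guard/mu.
by rewrite addnS; exact: (@runs_inc [:: m; p; u; i; u + j; j] 4).
Qed.

(** The word is read twice, once for each half of the selector. [Move 2 4] advances to the next word
    before register 4 is reused as a counter. *)
Definition emit_gadget : cmd :=
  Seq (Seq (emit_word [:: Some true; Some true; Some false])
      (Seq (for_loop 4 1 (emit_word [:: Some true; Some false]))
        (for_loop 4 1 (emit_word [:: None; Some false]))))
  (Seq (Seq (Seq (emit_word [:: None])
        (Seq (emit_guards false)
        (Seq (emit_word [:: None; Some false])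
          (emit_guards true))))
      (Seq (Move 2 4)
      (Seq (emit_word [:: Some true; Some false])
        (Seq (for_loop 4 1 (emit_word (nseq 2 None)))
        (Seq (emit_word [:: Some false])
        (Seq (for_loop 4 1 (emit_word (nseq 2 None)))
          (emit_word (nseq 2 None))))))))
    (Seq (for_loop 4 1 (emit_word (nseq 4 None)))
    (Seq (emit_word (nseq 3 None))
      (for_loop 4 0 (emit_word (nseq 1 None)))))).

Lemma runs_emit_gadget m p u i w :
  (forall j, j < p -> mm (u + j) = sym_code (w j)) ->
  runs [:: m; p; u; i] emit_gadget (100 * (p + m + 1)) (gadget m p w)
    [:: m; p; u + p; i].
Proof.
move=> mu.
have rep v b := @runs_repeat [:: m; p; u; i] 4 b v erefl.
have rep' v b := @runs_repeat [:: m; p; u + p; i] 4 b v erefl.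
have word l v : size l <= 5 -> runs l (emit_word v) (2 * size v + 1) v l.
  by move=> l5; apply: runs_emit_word; apply: leq_trans l5 _.
have guards b := @runs_emit_guards m p u i b w mu.
have move_u : runs [:: m; p; u; i; u + p] (Move 2 4) 1 [::] [:: m; p; u + p; i].
  by apply: (@runs_rcons _ _ _ _ _ (u + p)); exact: runs_move.
have stars k v b : flatten (mkseq (fun=> nseq k v) (nth 0 [:: m; p; u + p; i] b))
    = nseq (nth 0 [:: m; p; u + p; i] b * k) v by exact: flatten_mkseq_nseq.
have emit_prefix := runs_seq
  (word [:: m; p; u; i] [:: Some true; Some true; Some false] isT)
  (runs_seq (rep [:: Some true; Some false] 1 isT isT)
            (rep [:: None; Some false] 1 isT isT)).
have emit_selector := runs_seq (word [:: m; p; u; i] [:: None] isT)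
  (runs_seq (runs_rcons (l' := [:: m; p; u; i]) (guards false))
  (runs_seq (word [:: m; p; u; i] [:: None; Some false] isT) (guards true))).
have emit_trailer := runs_seq (rep' (nseq 2 None) 1 isT isT)
  (runs_seq (word [:: m; p; u + p; i] [:: Some false] isT)
  (runs_seq (rep' (nseq 2 None) 1 isT isT)
            (word [:: m; p; u + p; i] (nseq 2 None) isT))).
have emit_stars := runs_seq (rep' (nseq 4 None) 1 isT isT)
  (runs_seq (word [:: m; p; u + p; i] (nseq 3 None) isT)
            (rep' (nseq 1 None) 0 isT isT)).
rewrite !stars /= in emit_trailer emit_stars; rewrite [m * 1]muln1 in emit_stars.
have emit_core := runs_seq emit_selector (runs_seq move_u
  (runs_seq (word [:: m; p; u + p; i] [:: Some true; Some false] isT)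
    emit_trailer)).
(* The commands are nested like the concatenations in [gadget], so the outputs agree by
   conversion. *)
have := runs_seq emit_prefix (runs_seq emit_core emit_stars).
move/runs_le; apply.
by rewrite /=; lia.
Qed.

Definition reduction : cmd :=
  Seq (Const 2 0)
    (Seq (for_loop 3 0 emit_gadget)
      (for_loop 3 1
        (Seq (for_loop 4 1 (emit_word (nseq 4 None))) (emit_word (nseq 3 None))))).

Lemma runs_reduction m p w :
  (forall i j, i < m -> j < p -> mm (i * p + j) = sym_code (w i j)) ->
  runs [:: m; p] reduction
    (1 + (m * (100 * (p + m + 1) + 2) + 2 + (p * (p * 11 + 9 + 2) + 2)))
    (instance m p w) [:: m; p; m * p].
Proof.
move=> mw; rewrite -[instance _ _ _]cat0s /reduction.
apply: runs_seq; first exact: runs_const.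
apply: runs_seq.
  (* Register 2 runs through the multiples of [p], each gadget having advanced it by [p]; no product
     is computed. *)
  rewrite /=; apply: (@runs_for (fun i => [:: m; p; i * p])) => // i im.
  rewrite /= (mulSn i) (addnC p (i * p)); apply: runs_emit_gadget => j jp.
  exact: mw.
(* The final wild cards come out as [p] rows of [4 * p + 3], one per round of the outer loop. *)
rewrite -flatten_mkseq_nseq.
apply: (@runs_for (fun=> [:: m; p; m * p])) => // i ip.
rewrite nseqD -flatten_mkseq_nseq.
apply: (@runs_le _ _ (p * 11 + 2 + 7)); last by lia.
apply: runs_seq; first exact: (@runs_repeat [:: m; p; m * p; i] 4 1).
exact: runs_emit_word.
Qed.

End Program.

(** * Running time, length and equivalence *)

Lemma pmatchPn (A : eqType) (U T : pword A) : size U = size T -> ~~ pmatch U T ->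
  exists2 j, j < size U & ~~ sym_match (nth None U j) (nth None T j).
Proof.
move=> sz UT; pose ok j := sym_match (nth None U j) (nth None T j).
have [/allP all_ok | /allPn[j]] := boolP (all ok (iota 0 (size U))).
  case/pmatchP: UT; split=> // i iU; apply: all_ok.
  by rewrite mem_iota.
by rewrite mem_iota => jU ?; exists j.
Qed.

Theorem theorem5 :
  exists (reduction : cmd) (C c1 c2 : nat),
  forall (m p : nat) (W : m.-tuple (p.-tuple (option bool))),
  exists (T : pword bool) (t : nat),
    [/\ outputs_in_time reduction (input_state W) T t,
        t <= C * (size T).+1,
        (p + m) ^ 2 <= c1 * size T,
        size T <= c2 * (p + m) ^ 2
      & universal_mismatch_yes W <-> shortest_cover_yes T (4 * p + 3)].
Proof.
(* The factor 100 comes from the time bound for one gadget; 15 is attained at [m = 1], [p = 0]. For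
   [m = p = 0] the instance is empty, so the time bound needs the successor of the length. *)
exists reduction, 100, 1, 15 => m p W.
pose words := map val W; pose w i j := nth None (nth [::] words i) j.
have size_words : size words = m by rewrite size_map size_tuple.
have wE (i : 'I_m) : nth [::] words i = tnth W i.
  rewrite (nth_map (tnth W i)) ?size_tuple //.
  by rewrite -tnth_nth.
have size_word i : i < m -> size (nth [::] words i) = p.
  by move=> im; rewrite (wE (Ordinal im)) size_tuple.
have input_mem i j : i < m -> j < p ->
    nth 0 (map sym_code (flatten words)) (i * p + j) = sym_code (w i j).
  move=> im jp; rewrite -(mkseq_nth [::] words) size_words.
  rewrite (nth_map None) ?(nth_flatten_mkseq _ size_word) //.
  by rewrite (size_flatten_mkseq size_word); nia.
have [|t [s [run t_le [_ _ out_s]]]] :=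
    @runs_reduction _ _ _ _ input_mem (input_state W) [::].
  by [].
exists (instance m p w), t; rewrite size_instance; split.
- by exists s.
- by nia.
- by rewrite mul1n; nia.
- by nia.
split=> [[V VW] | [S [Sp cS]]].
  (* Wild cards of [V] may be resolved arbitrarily, here to 0, since a mismatch involves solid
     letters only. *)
  pose b j := nth None V j == Some true.
  exists (cover_word b p); rewrite size_mkseq; split=> //.
  apply: solid_cover_instance => i im; have := VW (Ordinal im).
  move=> /pmatchPn[|j]; rewrite !size_tuple // => jp mism; exists j => //.
  move: mism; rewrite /mismatch_at /w (wE (Ordinal im)) /b /sym_match.
  by case: (nth None V j) => [[]|]; case: (nth None (tnth W _) j) => [[]|].
exists [tuple Some (decode S p j) | j < p] => i; apply/negP => /pmatchP[_ VW].
have [j jp /eqP wj] := cover_mismatch (ltn_ord i) Sp cS.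
have := VW j; rewrite size_tuple => /(_ jp).
rewrite -wE -/(w i j) wj -[j in nth _ _ j]/(val (Ordinal jp)).
rewrite -tnth_nth tnth_mktuple.
by rewrite sym_match_Some /=; case: decode.
Qed.
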